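(* Let $\mathfrak{g}$ be a finite-dimensional complex simple Lie algebra. The set $\widetilde{\mathbf{CP}_{\mathfrak{g}}}=\{\tilde f_\phi\}_\phi$, where $\phi$ ranges over all finite-dimensional representations of $\mathfrak{g}$, is a commutative monoid under the resolution product $*$, with unit element $z_0$.
   Context: Fix a Cartan subalgebra $\mathfrak{h}$ with simple roots $\alpha_1,\dots,\alpha_n$ and coroots $h_{\alpha_1},\dots,h_{\alpha_n}$ forming a basis of $\mathfrak{h}$. For a finite-dimensional representation $\phi:\mathfrak{g}\to\mathfrak{gl}(V)$, $\tilde f_\phi(z_0,\dots,z_n)=\det\big(z_0I+\sum_{i=1}^n z_i\phi(h_{\alpha_i})\big)$. If $\Gamma_\phi$ is the set of weights of $\phi$ and $d_\lambda$ the multiplicity of $\lambda\in\Gamma_\phi$, then $\tilde f_\phi=\prod_{\lambda\in\Gamma_\phi}\big(z_0+\sum_{i}\lambda(h_{\alpha_i})z_i\big)^{d_\lambda}$. The resolution product is $\tilde f_\phi*\tilde f_\varphi=\prod_{\lambda\in\Gamma_\phi,\mu\in\Gamma_\varphi}\big(z_0+\sum_{i=1}^n(\lambda(h_{\alpha_i})+\mu(h_{\alpha_i}))z_i\big)^{d_\lambda d_\mu}$. *)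

(* Defs.v *)
From HB Require Import structures.
From mathcomp Require Import all_boot all_order all_algebra.
From mathcomp Require Import mpoly.
From mathcomp Require Import reals.
From mathcomp Require Import complex.

Set Implicit Arguments.
Unset Strict Implicit.
Unset Printing Implicit Defensive.

Import Order.TTheory GRing.Theory Num.Theory.
Local Open Scope ring_scope.

Section LieDefs.
Variables (C : fieldType) (L : vectType C) (br : L -> L -> L).

(* Lie bracket axioms: left linearity, alternating, Jacobi
   (right linearity follows). *)
Definition lie_bracket : Prop :=
  [/\ forall (a : C) (x y z : L), br (a *: x + y) z = a *: br x z + br y z,
      forall x : L, br x x = 0 &
      forall x y z : L, br x (br y z) + br y (br z x) + br z (br x y) = 0].

Definition lie_ideal (I : {vspace L}) : Prop :=
  forall x y : L, y \in I -> br x y \in I.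

Definition lie_simple : Prop :=
  (exists x y : L, br x y != 0) /\
  (forall I : {vspace L}, lie_ideal I -> I = 0%VS \/ I = fullv).

Definition lie_subalgebra (H : {vspace L}) : Prop :=
  forall x y : L, x \in H -> y \in H -> br x y \in H.

Fixpoint nest_br (x : L) (s : seq L) : L :=
  if s is y :: s' then br y (nest_br x s') else x.

(* H is nilpotent: some term of its lower central series vanishes *)
Definition lie_nilpotent (H : {vspace L}) : Prop :=
  exists k : nat, forall (x : L) (s : seq L),
    x \in H -> all (fun y => y \in H) s -> size s = k -> nest_br x s = 0.

Definition cartan (H : {vspace L}) : Prop :=
  [/\ lie_subalgebra H, lie_nilpotent H &
      forall x : L, (forall y, y \in H -> br x y \in H) -> x \in H].

(* x lies in the root space g_a, for a functional a (only its values on H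
   matter) *)
Definition in_rootspace (H : {vspace L}) (a : L -> C) (x : L) : Prop :=
  forall y : L, y \in H -> br y x = a y *: x.

Definition is_root (H : {vspace L}) (a : L -> C) : Prop :=
  (exists y, y \in H /\ a y != 0) /\ (exists x, x != 0 /\ in_rootspace H a x).

Definition simple_roots (H : {vspace L}) (n : nat) (al : 'I_n -> L -> C) : Prop :=
  [/\ forall i, is_root H (al i),
      n = \dim H,
      (forall c : 'I_n -> C,
          (forall y, y \in H -> \sum_i c i * al i y = 0) -> forall i, c i = 0) &
      forall b : L -> C, is_root H b ->
        exists k : 'I_n -> int,
          ((forall i, 0 <= k i) \/ (forall i, k i <= 0)) /\
          (forall y, y \in H -> b y = \sum_i (k i)%:~R * al i y)].

Definition coroot (H : {vspace L}) (a : L -> C) (hc : L) : Prop :=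
  [/\ hc \in H, a hc = 2 &
      exists x y, [/\ in_rootspace H a x, in_rootspace H (fun z => - a z) y
                    & hc = br x y]].

Definition lie_rep (N : nat) (phi : L -> 'M[C]_N) : Prop :=
  (forall (a : C) (x y : L), phi (a *: x + y) = a *: phi x + phi y) /\
  (forall x y : L, phi (br x y) = phi x *m phi y - phi y *m phi x).

End LieDefs.

Section Ftilde.
Variables (C : closedFieldType) (L : vectType C) (n : nat) (h : 'I_n -> L).

Definition zvar (i : 'I_n) : {mpoly C[n.+1]} := 'X_(lift ord0 i).

Definition ftilde (N : nat) (phi : L -> 'M[C]_N) : {mpoly C[n.+1]} :=
  \det (\matrix_(r, s) ((r == s)%:R * 'X_0 +
                        \sum_(i < n) (phi (h i) r s)%:MP * zvar i)).

(* a weight lambda is encoded by the sequence c = (lambda(h_1),...,lambda(h_n));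
   its multiplicity is the dimension of the weight space
   {v | phi(h_i) v = c_i v for all i} *)
Definition wmult (N : nat) (phi : L -> 'M[C]_N) (c : seq C) : nat :=
  \rank (\bigcap_(i < n) kermx ((phi (h i))^T - (c`_i)%:M))%MS.

Definition eig_list (N : nat) (A : 'M[C]_N) : seq C :=
  sval (closed_field_poly_normal (char_poly A)).

Definition cand_weights (N : nat) (phi : L -> 'M[C]_N) : seq (seq C) :=
  foldr (fun r acc => [seq x :: t | x <- r, t <- acc]) [:: [::]]
        [seq eig_list (phi (h i)) | i <- enum 'I_n].

Definition weights (N : nat) (phi : L -> 'M[C]_N) : seq (seq C) :=
  [seq c <- undup (cand_weights phi) | 0 < wmult phi c]%N.

Definition linform2 (c e : seq C) : {mpoly C[n.+1]} :=
  'X_0 + \sum_(i < n) (c`_i + e`_i)%:MP * zvar i.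

Definition resprod (N M : nat) (phi : L -> 'M[C]_N) (psi : L -> 'M[C]_M)
  : {mpoly C[n.+1]} :=
  \prod_(c <- weights phi) \prod_(e <- weights psi)
     linform2 c e ^+ (wmult phi c * wmult psi e).

End Ftilde.

(* Main.v *)
Require Import Defs.
From HB Require Import structures.
From mathcomp Require Import all_boot all_order all_algebra.
From mathcomp Require Import mpoly.
From mathcomp Require Import reals.
From mathcomp Require Import complex.
From mathcomp Require Import ring.
From mathcomp Require boolp.
Import Order.TTheory GRing.Theory Num.Theory.
Local Open Scope ring_scope.

Set Implicit Arguments.
Unset Strict Implicit.
Unset Printing Implicit Defensive.

(* A coroot [h_i] completes to an sl2-triple, so it acts diagonalizably in every
   finite-dimensional representation, and the matrices [phi (h_i)] commute.
   Hence they are simultaneously diagonal in some basis, with joint diagonal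
   entries [c_1, .., c_N] in [C^n]; [ftilde phi] is the product of the linear
   forms [z_0 + c_r . z], and the resolution product replaces the two multisets
   of weights by the multiset of all sums.  A product of such forms determines
   its multiset of weights, so the resolution product is an operation on
   polynomials, and it inherits associativity, commutativity and the unit from
   addition in [C^n].  Closure holds because the tensor product of two
   representations realises the sums of weights. *)

(** * Coordinatewise identities and iterates of linear maps *)

Ltac entrywise := apply/matrixP => ? ?; rewrite ?mxE.

Lemma iter_linearP (K : pzRingType) (V : lmodType K) (g : {linear V -> V}) k c u v :
  iter k g (c *: u + v) = c *: iter k g u + iter k g v.
Proof. by elim: k => //= k ->; rewrite linearP. Qed.

Lemma iter_linear0 (K : pzRingType) (V : lmodType K) (g : {linear V -> V}) k :
  iter k g 0 = 0.
Proof. by elim: k => //= k ->; exact: linear0. Qed.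

Lemma iter_linearZ (K : pzRingType) (V : lmodType K) (g : {linear V -> V}) k c u :
  iter k g (c *: u) = c *: iter k g u.
Proof. by have := iter_linearP g k c u 0; rewrite !addr0 iter_linear0 addr0. Qed.

(** * Finite-dimensional modules over sl2: semisimplicity of [h] *)

Section Sl2.
Variables (K : numFieldType) (N : nat).
Variables (e f h : {linear 'cV[K]_N -> 'cV[K]_N}).
Hypothesis he : forall v, h (e v) = e (h v) + 2 *: e v.
Hypothesis hf : forall v, h (f v) = f (h v) - 2 *: f v.
Hypothesis ef : forall v, e (f v) = f (e v) + h v.
(** Finiteness of this list of possible eigenvalues is what makes the ladder operators [e] and [f]
    terminate. *)
Variable spec : seq K.
Hypothesis hspec : forall v mu, h v = mu *: v -> v != 0 -> mu \in spec.

Let linE := (linearD e, linearD f, linearD h, linearN e, linearN f, linearN h,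
  linearZ_LR e, linearZ_LR f, linearZ_LR h, linear0 e, linear0 f, linear0 h).

(** Semisimplicity of [h] is tested by comparing the kernels of [hsub mu] and of its square. *)
Let hsub (mu : K) v := h v - mu *: v.

Lemma hsub_eigen mu v : hsub mu v = 0 -> h v = mu *: v.
Proof. by move/eqP; rewrite subr_eq0 => /eqP. Qed.

Lemma hsub_e mu v : hsub (mu + 2) (e v) = e (hsub mu v).
Proof. by rewrite /hsub he !linE; entrywise; ring. Qed.

Lemma hsub_f mu v : hsub (mu - 2) (f v) = f (hsub mu v).
Proof. by rewrite /hsub hf !linE; entrywise; ring. Qed.

Lemma hsub2_spec mu v : hsub mu (hsub mu v) = 0 -> v != 0 -> mu \in spec.
Proof.
move=> T2 v0; have [/hsub_eigen Tv|Tv] := eqVneq (hsub mu v) 0.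
  exact: hspec Tv v0.
exact: hspec (hsub_eigen T2) Tv.
Qed.

(** The [k]-th iterate of [v] is killed by the square of [hsub (mu + k a)]. The shifts are distinct
    in characteristic zero, so more than [size spec] nonzero iterates would give too many
    eigenvalues. *)
Lemma shift_nilpotent (g : 'cV[K]_N -> 'cV[K]_N) (a mu : K) v :
  a != 0 -> (forall nu u, hsub (nu + a) (g u) = g (hsub nu u)) -> g 0 = 0 ->
  hsub mu (hsub mu v) = 0 -> exists r, iter r g v = 0.
Proof.
move=> a0 Tg g0 T2.
have T2k k : hsub (mu + a *+ k) (hsub (mu + a *+ k) (iter k g v)) = 0.
  elim: k => [|k IH]; first by rewrite mulr0n addr0.
  by rewrite mulrSr addrA iterS !Tg IH.
case: (boolP [exists k : 'I_(size spec).+1, iter k g v == 0]).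
  by case/existsP=> k /eqP; exists k.
move/existsPn => nz; exfalso.
pose s := [seq mu + a *+ k | k <- iota 0 (size spec).+1].
have: (size s <= size spec)%N.
  apply: uniq_leq_size.
    rewrite map_inj_uniq ?iota_uniq // => i j /addrI /eqP.
    rewrite -subr_eq0 -mulr_natr -[a *+ j]mulr_natr -mulrBr mulf_eq0 (negPf a0).
    by rewrite /= subr_eq0 eqr_nat => /eqP.
  move=> x /mapP[k]; rewrite mem_iota => /andP[_ kn] ->.
  exact: hsub2_spec (T2k k) (nz (Ordinal kn)).
by rewrite size_map size_iota ltnn.
Qed.

Lemma e_nilpotent mu v : hsub mu (hsub mu v) = 0 -> exists r, iter r e v = 0.
Proof. by apply: (shift_nilpotent (a := 2)); rewrite ?pnatr_eq0 ?linear0 //; exact: hsub_e. Qed.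

Lemma f_nilpotent mu v : hsub mu (hsub mu v) = 0 -> exists r, iter r f v = 0.
Proof.
apply: (shift_nilpotent (a := - 2)); rewrite ?oppr_eq0 ?pnatr_eq0 ?linear0 //.
exact: hsub_f.
Qed.

Lemma h_iter_f k v : h (iter k f v) = iter k f (h v) - (2 * k)%:R *: iter k f v.
Proof.
elim: k => [|k IH]; first by rewrite muln0 scale0r subr0.
rewrite !iterS hf IH !linE mulnS natrD.
by entrywise; ring.
Qed.

(** Keeping [h v] instead of a scalar multiple of [v] lets the formula apply to generalized weight
    vectors. *)
Lemma e_iter_f k v : e v = 0 ->
  e (iter k.+1 f v) = k.+1%:R *: (iter k f (h v) - k%:R *: iter k f v).
Proof.
move=> ev; elim: k => [|k IH]; first by rewrite /= ef ev linear0; entrywise; ring.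
rewrite iterS ef IH h_iter_f !linE -!iterS natrM.
by entrywise; ring.
Qed.

(* The last nonzero [f^k w] is hit by [e f^(k+1)] with factor [(k+1)(mu-k)]. *)
Lemma highest_weight_nat mu w : e w = 0 -> h w = mu *: w -> w != 0 ->
  exists2 k, mu = k%:R & iter k.+1 f w = 0 /\ iter k f w != 0.
Proof.
move=> ew hw w0.
have [] := @f_nilpotent mu w; first by rewrite /hsub hw subrr linE scaler0 subr0.
elim=> [/eqP|k IH]; first by rewrite (negPf w0).
have [/IH//|fk0 fS0] := eqVneq (iter k f w) 0.
exists k => //; have := e_iter_f k ew.
rewrite fS0 linear0 hw iter_linearZ -scalerBl => /esym/eqP.
by rewrite !scaler_eq0 pnatr_eq0 (negPf fk0) orbF subr_eq0 => /eqP.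
Qed.

(** If [w = hsub mu v] is nonzero, it is a highest weight vector, so [mu = k] and [f^(k+1) w = 0].
    For [j > k] the factor [(j+1)(k-j)] is nonzero, so nilpotency of [f] descends to
    [f^(k+1) v = 0]; applying [e] gives [(k+1) f^k w = 0], a contradiction. *)
Lemma highest_weight_semisimple mu v :
  e v = 0 -> hsub mu (hsub mu v) = 0 -> hsub mu v = 0.
Proof.
move=> ev T2; apply/eqP/negPn/negP => w0.
have ew : e (hsub mu v) = 0 by rewrite -hsub_e /hsub ev linear0 scaler0 subr0.
have [k muk [fS0 fk0]] := highest_weight_nat ew (hsub_eigen T2) w0.
have hv : h v = mu *: v + hsub mu v by rewrite /hsub addrC subrK.
have fw j : (k < j)%N -> iter j f (hsub mu v) = 0.
  by move=> kj; rewrite -(subnK kj) iterD fS0 iter_linear0.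
have fv j : (k < j)%N -> iter j.+1 f v = 0 -> iter j f v = 0.
  move=> kj fj; have := e_iter_f j ev.
  rewrite fj linear0 hv iter_linearP fw // addr0 -scalerBl muk => /esym/eqP.
  rewrite !scaler_eq0 pnatr_eq0 subr_eq0 eqr_nat (ltn_eqF kj) /=.
  by move/eqP.
have [r fr] := f_nilpotent T2.
have fS j : iter (j + k.+1) f v = 0 -> iter k.+1 f v = 0.
  by elim: j => // j IH; rewrite addSn => /fv H; apply/IH/H; rewrite addnS ltnS leq_addl.
have := e_iter_f k ev; rewrite (fS r); last first.
  by rewrite addnC iterD fr iter_linear0.
rewrite linear0 hv iter_linearP muk addrAC subrr add0r => /esym/eqP.
by rewrite -muk scaler_eq0 pnatr_eq0 (negPf fk0).
Qed.

(* On the weight space [mu] the Casimir [4fe + (h+1)^2] has only the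
   eigenvalues [(mu+1+2j)^2], so subtracting any other [a] from it gives a
   surjective operator. *)
Lemma casimir_surjective a r : forall mu u, iter r e u = 0 -> h u = mu *: u ->
  (forall j : nat, a != (mu + 1 + (2 * j)%:R) ^+ 2) ->
  exists2 x, h x = mu *: x & 4 *: f (e x) + ((mu + 1) ^+ 2 - a) *: x = u.
Proof.
elim: r => [|r IH] mu u.
  by move=> /= -> _ _; exists 0; rewrite !linear0 // addr0.
rewrite iterSr => eu hu ha.
have [|j|y hy cy] := IH (mu + 2) _ eu.
- by rewrite he hu linE -scalerDl.
- by have := ha j.+1; rewrite mulnS natrD; congr (_ != _ ^+ 2); ring.
set d := _ - a; have d0 : d != 0.
  by have := ha 0%N; rewrite muln0 addr0 subr_eq0 eq_sym.
(* This choice gives [e x = y]: in the equation for [y], the term [4 h y] coming from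
   [e f = f e + h] accounts for [(mu+3)^2 - (mu+1)^2 = 4(mu+2)]. *)
exists (d^-1 *: (u - 4 *: f y)).
  by rewrite !linE hf hu hy !linE; entrywise; ring.
rewrite !linE ef hy -cy !linE.
by entrywise; rewrite /d; field.
Qed.

(* Induction on the order of [v] under [e]: by surjectivity of the shifted
   Casimir, [e v = e (f x)] with [f x] a true weight vector, which reduces [v] to
   [v - f x] in the kernel of [e]. *)
Lemma h_semisimple mu v : hsub mu (hsub mu v) = 0 -> hsub mu v = 0.
Proof.
move=> T2; have [r] := e_nilpotent T2; elim: r mu v T2 => [|r IH] mu v T2.
  by move=> /= ->; rewrite /hsub linear0 scaler0 subr0.
rewrite iterSr => er.
have [//|w0] := eqVneq (hsub mu v) 0.
have Tu : hsub (mu + 2) (e v) = 0 by apply: IH er; rewrite !hsub_e T2 linear0.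
have ew : e (hsub mu v) = 0 by rewrite -hsub_e.
have [k muk _] := highest_weight_nat ew (hsub_eigen T2) w0.
(* On weight [mu + 2] the Casimir minus [(mu+1)^2] is [4 f e + 4 h = 4 e f], so the equation becomes
   [e (f x) = e v]. As [mu] is a natural number, [(mu+1)^2] differs from every [(mu+3+2j)^2]. *)
have [||j|x hx cx] := @casimir_surjective ((mu + 1) ^+ 2) r (mu + 2) (4 *: e v).
- by rewrite iter_linearZ er scaler0.
- by rewrite linE (hsub_eigen Tu); entrywise; ring.
- rewrite muk -natrD !natr1 -natrD -!natrX eqr_nat eqn_exp2r //.
  by rewrite addn2 neq_ltn ltn_addr.
have efx : e (f x) = e v.
  apply: (scalerI (a := 4)); first by rewrite pnatr_eq0.
  by rewrite -cx ef hx; entrywise; ring.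
have Tv : hsub mu (v - f x) = hsub mu v.
  by rewrite /hsub !linE hf hx !linE; entrywise; ring.
by rewrite -Tv; apply: highest_weight_semisimple; rewrite ?linE ?efx ?subrr // Tv T2.
Qed.
End Sl2.

(** * Diagonalizability and ranks of matrices *)

Lemma col_eigenvalue (F : fieldType) N (A : 'M[F]_N) (v : 'cV[F]_N) a :
  A *m v = a *: v -> v != 0 -> root (char_poly A) a.
Proof.
move=> Av v0; have -> : char_poly A = char_poly A^T.
  by rewrite /char_poly -det_tr /char_poly_mx linearB /= tr_scalar_mx map_trmx.
rewrite -eigenvalue_root_char.
apply/eigenvalueP; exists v^T; first by rewrite -trmx_mul Av linearZ.
by rewrite -trmx0 (inj_eq trmx_inj).
Qed.

Lemma not_uniq_perm (T : eqType) (s : seq T) :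
  ~~ uniq s -> exists a t, perm_eq s (a :: a :: t).
Proof.
elim: s => //= x s IH; have [xs _|_ /= /IH [a [t st]]] := boolP (x \in s).
  by exists x, (rem x s); rewrite perm_cons perm_to_rem.
exists a, (x :: t); rewrite -(perm_cons x) in st.
by apply: perm_trans st _; exact: (permEl (perm_catCA [:: x] [:: a; a] t)).
Qed.

(** If the minimal polynomial had a double root [a], dropping one factor ['X - a%:P] would still
    leave a polynomial annihilating [A], by the kernel hypothesis, against minimality. *)
Lemma diagonalizable_of_ker2 (F : closedFieldType) N (A : 'M[F]_N) :
  (forall a (v : 'cV_N),
     A *m (A *m v - a *: v) - a *: (A *m v - a *: v) = 0 -> A *m v - a *: v = 0) ->
  diagonalizable A.
Proof.
case: N A => [|N] A ker2.
  by exists 1%:M; rewrite ?unitmx1 //; apply/is_diag_mxP => -[].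
apply/diagonalizableP.
have [rs] := closed_field_poly_normal (mxminpoly A).
rewrite (monicP (mxminpoly_monic A)) scale1r => pE.
exists rs; last by rewrite pE.
apply/negPn/negP => /not_uniq_perm[a [t rst]].
have {}pE : mxminpoly A = ('X - a%:P) * (('X - a%:P) * \prod_(x <- t) ('X - x%:P)).
  by rewrite pE (perm_big _ rst) !big_cons.
set q := \prod_(x <- t) _ in pE.
have XaE (u : 'cV[F]_N.+1) : horner_mx A ('X - a%:P) *m u = A *m u - a *: u.
  by rewrite rmorphB /= horner_mx_X horner_mx_C mulmxBl mul_scalar_mx.
have Aq : horner_mx A (('X - a%:P) * q) = 0.
  apply/matrixP => r s.
  suff H : horner_mx A (('X - a%:P) * q) *m delta_mx s ord0 = 0 :> 'cV_N.+1.
    by have /matrixP/(_ r ord0) := H; rewrite -colE !mxE.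
  rewrite rmorphM /= -mulmxE -mulmxA XaE; apply: ker2.
  by rewrite -!XaE !mulmxA !mulmxE -!rmorphM /= -!mulrA -pE mx_root_minpoly mul0mx.
have q0 : ('X - a%:P) * q != 0.
  by rewrite mulf_neq0 ?polyXsubC_eq0 // monic_neq0 // monic_prod_XsubC.
have := dvdp_leq q0 (mxminpoly_min Aq).
by rewrite pE mulrC size_Mmonic ?monicXsubC // size_XsubC addn2 ltnn.
Qed.

Lemma sl2_diagonalizable (K : numClosedFieldType) N (E F H : 'M[K]_N) :
  H *m E - E *m H = 2 *: E -> H *m F - F *m H = - (2 *: F) ->
  E *m F - F *m E = H -> diagonalizable H.
Proof.
move=> HE HF EF; apply: diagonalizable_of_ker2.
have [rs] := closed_field_poly_normal (char_poly H).
rewrite (monicP (char_poly_monic H)) scale1r => cE.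
apply: (@h_semisimple _ _ (mulmx E) (mulmx F) (mulmx H) _ _ _ rs).
- by move=> v /=; rewrite !mulmxA scalemxAl -mulmxDl -HE addrC subrK.
- by move=> v /=; rewrite !mulmxA scalemxAl -mulNmx -mulmxDl -HF addrC subrK.
- by move=> v /=; rewrite !mulmxA -mulmxDl -EF addrC subrK.
by move=> v mu Hv v0; rewrite -root_prod_XsubC -cE; apply: col_eigenvalue Hv v0.
Qed.

(** The diagonal matrix factors as [M^T *m M], where the 0/1 matrix [M] selects the coordinates in
    [S]; since [M *m M^T = 1], both ranks are [#|S|]. *)
Lemma rank_diag_indicator (F : fieldType) N (S : {set 'I_N}) :
  \rank (diag_mx (\row_r (r \in S)%:R) : 'M[F]_N) = #|S|.
Proof.
pose M : 'M[F]_(#|S|, N) := \matrix_(k, r) (enum_val k == r)%:R.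
have MMt : M *m M^T = 1%:M.
  apply/matrixP=> k l; rewrite !mxE (bigD1 (enum_val k)) //= !mxE eqxx mul1r.
  rewrite big1 => [|r rk]; last by rewrite !mxE eq_sym (negPf rk) mul0r.
  by rewrite addr0 (inj_eq enum_val_inj) eq_sym.
have MtM : M^T *m M = diag_mx (\row_r (r \in S)%:R).
  apply/matrixP=> r s; rewrite !mxE; have [rS|rS] := boolP (r \in S).
    rewrite (bigD1 (enum_rank_in rS r)) //= !mxE enum_rankK_in // eqxx mul1r.
    rewrite big1 ?addr0 // => k kr; rewrite !mxE.
    case: eqP => [krE|]; last by rewrite mul0r.
    by case/eqP: kr; apply: enum_val_inj; rewrite enum_rankK_in.
  rewrite big1 ?mul0rn // => k _; rewrite !mxE.
  by case: eqP => [kr|_]; rewrite ?mul0r //; case/negP: rS; rewrite -kr enum_valP.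
have rM : \rank M = #|S| by apply/eqP/row_freeP; exists M^T.
rewrite -MtM; apply/eqP; rewrite -{3}rM eqn_leq mxrankM_maxr /=.
by rewrite -{1}[M]mul1mx -MMt -mulmxA mxrankM_maxr.
Qed.

(** * Products of linear forms and their multisets of coefficients *)

Section LinearForms.
Variables (C : closedFieldType) (n : nat).
Implicit Types (c : 'rV[C]_n) (W : seq 'rV[C]_n).

Definition linform c : {mpoly C[n.+1]} := 'X_0 + \sum_(i < n) (c 0 i)%:MP * zvar C i.

Definition linprod W : {mpoly C[n.+1]} := \prod_(c <- W) linform c.

Lemma mcoeff_linform c (i : 'I_n) : (linform c)@_(U_(lift ord0 i)) = c 0 i.
Proof.
rewrite mcoeffD mcoeffXU (negPf (neq_lift _ _)) add0r raddf_sum (bigD1 i) //=.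
rewrite mcoeffCM mcoeffXU eqxx mulr1 big1 ?addr0 // => j ji.
by rewrite mcoeffCM mcoeffXU (inj_eq lift_inj) (negPf ji) mulr0.
Qed.

Lemma linform_inj : injective linform.
Proof. by move=> c d cd; apply/rowP => i; rewrite -!mcoeff_linform cd. Qed.

Lemma linform_neq0 c : linform c != 0.
Proof.
apply/eqP => /(congr1 (mcoeff U_(ord0))).
rewrite mcoeffD mcoeffXU eqxx raddf_sum big1 /= ?addr0 => [|i _].
  by rewrite mcoeff0 => /eqP; rewrite oner_eq0.
by rewrite mcoeffCM mcoeffXU eq_sym (negPf (neq_lift _ _)) mulr0.
Qed.

(** Restriction to the hyperplane where [linform c] vanishes, with [z_0] eliminated. *)
Definition linsubst c : {mpoly C[n.+1]} -> {mpoly C[n.+1]} :=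
  comp_mpoly [tuple if i == ord0 then 'X_0 - linform c else 'X_i | i < n.+1].

Lemma linsubst_linform c d : linsubst c (linform d) = linform d - linform c.
Proof.
rewrite /linsubst [linform d]/linform comp_mpolyD comp_mpolyXU -tnth_nth.
rewrite tnth_mktuple eqxx [RHS]addrAC; congr (_ + _).
rewrite raddf_sum; apply: eq_bigr => i _.
rewrite /= rmorphM /= comp_mpolyC comp_mpolyXU -tnth_nth tnth_mktuple.
by rewrite eq_sym (negPf (neq_lift _ _)).
Qed.

(** The polynomial ring is a domain, and among the forms only [linform c] dies on its hyperplane. *)
Lemma linsubst_linprod_eq0 c W : (linsubst c (linprod W) == 0) = (c \in W).
Proof.
rewrite /linprod /linsubst rmorph_prod prodf_seq_eq0 /= -has_pred1.
apply: eq_has => d /=.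
by rewrite -/(linsubst c _) linsubst_linform subr_eq0 (inj_eq linform_inj).
Qed.

(* Unique factorisation into the forms [linform c], read off by the
   substitutions that kill exactly one of them. *)
Lemma linprod_perm W1 W2 : linprod W1 = linprod W2 -> perm_eq W1 W2.
Proof.
elim: W1 W2 => [|c W1 IH] W2 eqW.
  case: W2 eqW => // c W2 eqW.
  by have := linsubst_linprod_eq0 c [::]; rewrite eqW linsubst_linprod_eq0 mem_head.
have cW2 : c \in W2 by rewrite -linsubst_linprod_eq0 -eqW linsubst_linprod_eq0 mem_head.
have W2E := perm_to_rem cW2.
move: eqW; rewrite /linprod (perm_big _ W2E) !big_cons => /(mulfI (linform_neq0 c)).
move/IH; rewrite -(perm_cons c) => W12; apply: perm_trans W12 _.
by rewrite perm_sym.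
Qed.

Definition sumset W1 W2 := [seq c + d | c <- W1, d <- W2].

Lemma linprod_sumset W1 W2 :
  linprod (sumset W1 W2) = \prod_(c <- W1) \prod_(d <- W2) linform (c + d).
Proof. by rewrite /linprod big_allpairs_dep. Qed.
End LinearForms.

(** * Characteristic polynomial and weights in a common eigenbasis *)

Section Weights.
Variables (C : closedFieldType) (L : vectType C) (n : nat) (h : 'I_n -> L).

Definition diagonalizes N (phi : L -> 'M[C]_N) (P : 'M[C]_N) (D : 'I_n -> 'rV[C]_N) :=
  P \in unitmx /\ forall i, phi (h i) = invmx P *m diag_mx (D i) *m P.

Definition diag_weight N (D : 'I_n -> 'rV[C]_N) (r : 'I_N) : 'rV[C]_n :=
  \row_i D i 0 r.

Definition diag_weights N (D : 'I_n -> 'rV[C]_N) : seq 'rV[C]_n :=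
  [seq diag_weight D r | r <- enum 'I_N].

(** Passes from row vectors, which can be added, to the sequences that encode weights in [weights]
    and [wmult]. *)
Definition row_seq (c : 'rV[C]_n) : seq C := [seq c 0 i | i <- enum 'I_n].

Lemma nth_row_seq c (i : 'I_n) : (row_seq c)`_i = c 0 i.
Proof. by rewrite (nth_map i) ?nth_ord_enum // size_enum_ord. Qed.

Lemma row_seqK (c : seq C) : size c = n -> row_seq (\row_i c`_i) = c.
Proof.
move=> cn; apply: (@eq_from_nth _ 0); first by rewrite size_map size_enum_ord.
move=> k; rewrite size_map size_enum_ord => kn.
by rewrite (nth_row_seq _ (Ordinal kn)) mxE.
Qed.

Lemma row_seqE c : \row_i (row_seq c)`_i = c.
Proof. by apply/rowP => i; rewrite mxE nth_row_seq. Qed.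

Lemma row_seq_inj : injective row_seq.
Proof. by move=> c d cd; rewrite -[c]row_seqE cd row_seqE. Qed.

Lemma linform2_row_seq c d : linform2 n (row_seq c) (row_seq d) = linform (c + d).
Proof.
by congr (_ + _); apply: eq_bigr => i _; rewrite !nth_row_seq mxE.
Qed.

Section Diagonalized.
Variables (N : nat) (phi : L -> 'M[C]_N) (P : 'M[C]_N) (D : 'I_n -> 'rV[C]_N).
Hypothesis PD : diagonalizes phi P D.

Lemma ftilde_diag : ftilde h phi = linprod (diag_weights D).
Proof.
case: PD => Pu phiE; rewrite /linprod big_map enumT -/(index_enum _).
pose m := @map_mx _ _ (@mpolyC n.+1 C) N N.
have mPP : m (invmx P) *m m P = 1%:M by rewrite -map_mxM mulVmx // map_mx1.
rewrite /ftilde.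
(* Carried over to polynomial entries, conjugation by [P] diagonalizes the whole pencil without
   changing the determinant. *)
transitivity (\det (m (invmx P) *m diag_mx (\row_r linform (diag_weight D r)) *m m P)).
  congr (\det _).
  have -> : diag_mx (\row_r linform (diag_weight D r)) =
     ('X_0)%:M + \sum_(i < n) zvar C i *: m (diag_mx (D i)).
    apply/matrixP => r s; rewrite !mxE summxE mulrnDl; congr (_ + _).
    rewrite -sumrMnl; apply: eq_bigr => i _; rewrite !mxE.
    by rewrite mulrC; case: eqP; rewrite ?mulr1n ?mulr0n ?mpolyC0 ?mulr0.
  rewrite mulmxDr mulmxDl mul_mx_scalar -scalemxAl mPP scalemx1 mulmx_sumr mulmx_suml.
  apply/matrixP => r s; rewrite !mxE summxE mulr_natl; congr (_ + _).
  apply: eq_bigr => i _; rewrite -scalemxAr -scalemxAl /m -!map_mxM -phiE !mxE.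
  exact: mulrC.
rewrite !det_mulmx mulrAC -det_mulmx mPP det1 mul1r det_diag.
by apply: eq_bigr => r _; rewrite mxE.
Qed.

(** Multiplication by [P^T] carries the joint eigenspace to the coordinate subspace of the indices
    whose diagonal weight is [c]. *)
Lemma wmult_diag (c : seq C) :
  wmult h phi c = #|[set r | diag_weight D r == \row_i c`_i]|.
Proof.
case: PD => Pu phiE; rewrite /wmult; set S := [set r | _].
have Ptu : P^T \in unitmx by rewrite unitmx_tr.
have phiT i : (phi (h i))^T = P^T *m diag_mx (D i) *m invmx P^T.
  by rewrite phiE !trmx_mul tr_diag_mx trmx_inv mulmxA.
have phic i : P^T *m (diag_mx (D i) - (c`_i)%:M) *m invmx P^T = (phi (h i))^T - (c`_i)%:M.
  by rewrite mulmxBr mulmxBl -phiT mul_mx_scalar -scalemxAl mulmxV ?scalemx1.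
have -> : \rank (\bigcap_(i < n) kermx ((phi (h i))^T - (c`_i)%:M))%MS
  = \rank (diag_mx (\row_r (r \in S)%:R) *m invmx P^T).
  apply/eqmx_rank/andP; split; last first.
    apply/sub_bigcapmxP => i _; apply/sub_kermxP.
    rewrite -phic !mulmxA mulmxKV // [X in X *m _](_ : _ = 0) ?mul0mx //.
    apply/matrixP => r s; rewrite mul_diag_mx !mxE inE.
    case: eqP => [/rowP/(_ i)|]; rewrite ?mul0r // !mxE => ->.
    by rewrite subrr mulr0.
  set X := (\bigcap_(i < n) _)%MS.
  have XP i : X *m P^T *m (diag_mx (D i) - (c`_i)%:M) = 0.
    have : (X <= kermx ((phi (h i))^T - (c`_i)%:M))%MS by apply: bigcapmx_inf.
    move/sub_kermxP; rewrite -phic !mulmxA => /(congr1 (mulmx^~ P^T)).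
    by rewrite mulmxKV ?mul0mx.
  (* An index [r] outside [S] has some [D i 0 r] different from [c_i], which forces column [r] of
     [X *m P^T] to vanish. *)
  have XE : X *m P^T *m diag_mx (\row_r (r \in S)%:R) = X *m P^T.
    apply/matrixP => a r; rewrite mul_mx_diag mxE [X in _ * X]mxE inE.
    case: eqP => [_|rc]; rewrite ?mulr1 // mulr0; apply/esym.
    have [i ric] : exists i, D i 0 r != c`_i.
      apply/existsP; apply: contraPT isT => /existsPn ri; case: rc.
      by apply/rowP => i; rewrite !mxE; apply/eqP/negPn/ri.
    have /matrixP/(_ a r)/eqP := XP i.
    rewrite mulmxBr mul_mx_diag mul_mx_scalar !mxE [c`_i * _]mulrC -mulrBr.
    by rewrite mulf_eq0 subr_eq0 (negPf ric) orbF => /eqP.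
  by apply/submxP; exists (X *m P^T); rewrite mulmxA XE mulmxK.
by rewrite mxrankMfree ?row_free_unit ?unitmx_inv // rank_diag_indicator.
Qed.

Lemma eig_list_diag i r : D i 0 r \in eig_list (phi (h i)).
Proof.
case: PD => Pu phiE; rewrite /eig_list; case: closed_field_poly_normal => s /=.
rewrite (monicP (char_poly_monic _)) scale1r -root_prod_XsubC => <-.
rewrite -eigenvalue_root_char; apply/eigenvalueP; exists (row r P).
  rewrite phiE -row_mul !mulmxA mulmxV // mul1mx row_mul row_diag_mx.
  by rewrite -scalemxAl -rowE.
apply/eqP => /(congr1 (mulmx^~ (invmx P))); rewrite rowE mulmxK // mul0mx.
by move/rowP/(_ r)/eqP; rewrite !mxE !eqxx oner_eq0.
Qed.

Lemma mem_cand_weights r : row_seq (diag_weight D r) \in cand_weights h phi.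
Proof.
rewrite /cand_weights /row_seq; elim: (enum 'I_n) => //= i s IH.
by apply/allpairsP; exists (D i 0 r, [seq diag_weight D r 0 i | i <- s]); rewrite mxE eig_list_diag.
Qed.

Lemma size_cand_weights c : c \in cand_weights h phi -> size c = n.
Proof.
rewrite /cand_weights -[RHS](size_enum_ord n); elim: (enum 'I_n) c => [|i s IH] c /=.
  by rewrite inE => /eqP ->.
by case/allpairsP => -[x t] /= [_ /IH st ->] /=; rewrite st.
Qed.

Lemma mem_weights : weights h phi =i [seq row_seq c | c <- diag_weights D].
Proof.
move=> c; rewrite mem_filter mem_undup wmult_diag card_gt0.
apply/andP/mapP => [[/set0Pn[r]]|[_ /mapP[r _ ->] ->]].
  rewrite inE => /eqP rc /size_cand_weights cn.
  by exists (diag_weight D r); rewrite ?rc ?row_seqK // -rc map_f // mem_enum.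
split; last exact: mem_cand_weights.
by apply/set0Pn; exists r; rewrite inE row_seqE.
Qed.

(** Exponents count repetitions: by [wmult_diag], the multiplicity of a weight is its number of
    occurrences among the diagonal weights. *)
Lemma weights_prod (A : comNzRingType) (G : seq C -> A) :
  \prod_(c <- weights h phi) G c ^+ wmult h phi c
  = \prod_(c <- diag_weights D) G (row_seq c).
Proof.
rewrite -(big_map (@row_seq) xpredT G) -[RHS]big_undup_iterop_count.
set W := [seq row_seq c | c <- _].
have WW : perm_eq (weights h phi) (undup W).
  apply: uniq_perm; rewrite ?undup_uniq ?filter_uniq ?undup_uniq // => c.
  by rewrite mem_undup mem_weights.
rewrite (perm_big _ WW) big_seq [RHS]big_seq; apply: eq_bigr => c.
rewrite mem_undup => /mapP[d _ cE].
rewrite -[RHS]/(G c ^+ count_mem c W); congr (_ ^+ _).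
rewrite wmult_diag cE row_seqE cardsE cardE size_filter.
rewrite /W /diag_weights -map_comp [RHS]count_map enumT; apply: eq_count => r /=.
by rewrite (inj_eq row_seq_inj).
Qed.

End Diagonalized.

Lemma resprod_diag N M (phi : L -> 'M[C]_N) (psi : L -> 'M[C]_M) P D Q E :
  diagonalizes phi P D -> diagonalizes psi Q E ->
  resprod h phi psi = linprod (sumset (diag_weights D) (diag_weights E)).
Proof.
move=> PD QE; rewrite linprod_sumset /resprod.
transitivity (\prod_(c <- weights h phi)
   (\prod_(d <- diag_weights E) linform2 n c (row_seq d)) ^+ wmult h phi c).
  apply: eq_bigr => c _; rewrite -(weights_prod QE (linform2 n c)) -prodrXl.
  by apply: eq_bigr => d _; rewrite -exprM mulnC.
rewrite (weights_prod PD); apply: eq_bigr => c _; apply: eq_bigr => d _.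
exact: linform2_row_seq.
Qed.
End Weights.

(** * Kronecker products of matrices *)

Section Kronecker.
Variables (C : fieldType) (N M : nat).
Implicit Types (A : 'M[C]_N) (B : 'M[C]_M).

Definition kron A B : 'M[C]_#|{: 'I_N * 'I_M}| :=
  \matrix_(a, b) (A (enum_val a).1 (enum_val b).1 * B (enum_val a).2 (enum_val b).2).

Lemma kronM A A' B B' : kron A B *m kron A' B' = kron (A *m A') (B *m B').
Proof.
apply/matrixP => a b; rewrite !mxE big_distrlr pair_big /=.
rewrite (reindex (enum_val : 'I_#|{: 'I_N * 'I_M}| -> _)) /=; last first.
  by apply: onW_bij; exact: enum_val_bij.
by apply: eq_bigr => k _; rewrite !mxE mulrACA.
Qed.

Lemma kron_diag (d : 'rV[C]_N) (e : 'rV[C]_M) :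
  kron (diag_mx d) (diag_mx e) =
  diag_mx (\row_a (d 0 (enum_val a).1 * e 0 (enum_val a).2)).
Proof.
apply/matrixP => a b; rewrite !mxE -(inj_eq enum_val_inj a b) -pair_eqE /pair_eq /=.
by do 2!case: eqP => _; rewrite ?mulr1n ?mulr0n ?mulr0 ?mul0r.
Qed.

Lemma kron1 : kron 1%:M 1%:M = 1%:M.
Proof.
rewrite -!diag_const_mx kron_diag; congr diag_mx.
by apply/rowP => a; rewrite !mxE mulr1.
Qed.

Lemma kronPl (k : C) A A' B : kron (k *: A + A') B = k *: kron A B + kron A' B.
Proof. by apply/matrixP => a b; rewrite !mxE mulrDl mulrA. Qed.

Lemma kronPr (k : C) A B B' : kron A (k *: B + B') = k *: kron A B + kron A B'.
Proof. by apply/matrixP => a b; rewrite !mxE mulrDr mulrCA. Qed.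

Lemma kronBl A A' B : kron (A - A') B = kron A B - kron A' B.
Proof. by apply/matrixP => a b; rewrite !mxE mulrBl. Qed.

Lemma kronBr A B B' : kron A (B - B') = kron A B - kron A B'.
Proof. by apply/matrixP => a b; rewrite !mxE mulrBr. Qed.

Lemma kron_unit A B : A \in unitmx -> B \in unitmx ->
  kron A B \in unitmx /\ invmx (kron A B) = kron (invmx A) (invmx B).
Proof.
move=> Au Bu.
have AB1 : kron (invmx A) (invmx B) *m kron A B = 1%:M.
  by rewrite kronM !mulVmx // kron1.
have [_ ABu] := mulmx1_unit AB1; split=> //.
by rewrite -[LHS]mul1mx -AB1 mulmxK.
Qed.
End Kronecker.

(** * Tensor products of representations *)

Section TensorRep.
Variables (C : closedFieldType) (L : vectType C) (br : L -> L -> L).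
Variables (n : nat) (h : 'I_n -> L) (N M : nat).
Variables (phi : L -> 'M[C]_N) (psi : L -> 'M[C]_M).

Definition tensor_rep (x : L) : 'M[C]_#|{: 'I_N * 'I_M}| :=
  kron (phi x) 1%:M + kron 1%:M (psi x).

(** The mixed terms [kron (phi x) (psi y)] and [kron (phi y) (psi x)] occur in both products and
    cancel in the commutator. *)
Lemma tensor_lie_rep : lie_rep br phi -> lie_rep br psi -> lie_rep br tensor_rep.
Proof.
move=> [phiP phiB] [psiP psiB]; split=> [a x y|x y].
  by rewrite /tensor_rep phiP psiP kronPl kronPr scalerDr addrACA.
rewrite /tensor_rep phiB psiB kronBl kronBr.
rewrite !mulmxDl !mulmxDr !kronM !mulmx1 !mul1mx.
move: (kron (_ *m _) _) (kron (_ *m _) _) (kron _ (_ *m _)) (kron _ (_ *m _)).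
move: (kron _ _) (kron _ _) => A B A1 A2 B1 B2.
by apply/matrixP => a b; rewrite !mxE; ring.
Qed.

Lemma tensor_diagonalizes P D Q E :
  diagonalizes h phi P D -> diagonalizes h psi Q E ->
  diagonalizes h tensor_rep (kron P Q)
    (fun i => \row_a (D i 0 (enum_val a).1 + E i 0 (enum_val a).2)).
Proof.
move=> [Pu phiE] [Qu psiE]; have [PQu PQi] := kron_unit Pu Qu; split=> // i.
rewrite PQi /tensor_rep phiE psiE.
have <- : kron (diag_mx (D i)) 1%:M + kron 1%:M (diag_mx (E i)) =
    diag_mx (\row_a (D i 0 (enum_val a).1 + E i 0 (enum_val a).2)).
  rewrite -!diag_const_mx !kron_diag -linearD; congr diag_mx.
  by apply/rowP => a; rewrite !mxE mulr1 mul1r.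
by rewrite mulmxDr mulmxDl !kronM !mulmx1 !mulVmx.
Qed.

Lemma ftilde_tensor P D Q E :
  diagonalizes h phi P D -> diagonalizes h psi Q E ->
  ftilde h tensor_rep = linprod (sumset (diag_weights D) (diag_weights E)).
Proof.
move=> PD QE; rewrite (ftilde_diag (tensor_diagonalizes PD QE)) linprod_sumset.
rewrite /linprod /diag_weights !big_map !enumT.
under [RHS]eq_bigr do rewrite big_map -/(index_enum _).
rewrite -!/(index_enum _) pair_big.
rewrite [RHS](reindex (enum_val : 'I_#|{: 'I_N * 'I_M}| -> _)) /=; last first.
  by apply: onW_bij; exact: enum_val_bij.
apply: eq_bigr => a _; congr linform.
by apply/rowP => i; rewrite !mxE.
Qed.
End TensorRep.

(** * Simultaneous diagonalization of the coroots *)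

Section Coroots.
Variables (K : numClosedFieldType) (L : vectType K) (br : L -> L -> L).
Variables (H : {vspace L}) (n : nat) (al : 'I_n -> L -> K) (h : 'I_n -> L).
Hypothesis hP : forall i, coroot br H (al i) (h i).

Lemma lie_rep0 N (phi : L -> 'M[K]_N) : lie_rep br phi -> phi 0 = 0.
Proof.
by case=> phiP _; have := phiP (-1) 0 0; rewrite scaler0 addr0 scaleN1r addNr.
Qed.

Lemma lie_repZ N (phi : L -> 'M[K]_N) a x : lie_rep br phi -> phi (a *: x) = a *: phi x.
Proof.
by move=> phiR; have [phiP _] := phiR; rewrite -[a *: x]addr0 phiP (lie_rep0 phiR) addr0.
Qed.

(* Commuting past [phi x] and [phi y] produces opposite multiples, since [x]
   and [y] are root vectors for opposite roots. *)
Lemma coroot_comm N (phi : L -> 'M[K]_N) i j :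
  lie_rep br phi -> comm_mx (phi (h i)) (phi (h j)).
Proof.
move=> phiR; have [_ phiB] := phiR.
have [hiH _ _] := hP i; have [_ _ [x [y [xR yR ->]]]] := hP j.
set a := al j (h i); set A := phi (h i).
have Ax : A *m phi x = phi x *m A + a *: phi x.
  by rewrite -lie_repZ // -xR // phiB addrC subrK.
have Ay : A *m phi y = phi y *m A - a *: phi y.
  by rewrite -scaleNr -lie_repZ // -(yR _ hiH) phiB addrC subrK.
rewrite /comm_mx phiB mulmxBr mulmxBl !mulmxA Ax Ay !mulmxBl !mulmxDl -!mulmxA.
by rewrite Ax Ay mulmxBr mulmxDr -!scalemxAl -!scalemxAr subrK addrK.
Qed.

(** The normalization [al i (h i) = 2] turns the images of the root vectors and of the coroot into
    an sl2-triple. *)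
Lemma coroot_diagonalizable N (phi : L -> 'M[K]_N) i :
  lie_rep br phi -> diagonalizable (phi (h i)).
Proof.
move=> phiR; have [_ phiB] := phiR.
have [hiH ali [x [y [xR yR hE]]]] := hP i.
apply: (@sl2_diagonalizable _ _ (phi x) (phi y)).
- by rewrite -phiB xR // ali lie_repZ.
- by rewrite -phiB yR // ali lie_repZ // scaleNr.
by rewrite -phiB -hE.
Qed.

Lemma coroot_codiagonalizes N (phi : L -> 'M[K]_N) :
  lie_rep br phi -> exists P D, diagonalizes h phi P D.
Proof.
move=> phiR.
have [|P Pu /allP PD] := (codiagonalizableP [seq phi (h i) | i <- enum 'I_n]).1.
  split=> [A B /mapP[i _ ->] /mapP[j _ ->]|A /mapP[i _ ->]].
    exact: coroot_comm.
  exact: coroot_diagonalizable.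
have /fin_all_exists[D DE] i : exists d, phi (h i) = invmx P *m diag_mx d *m P.
  have /PD/(diagonalizable_forLR Pu)[d ->] : phi (h i) \in [seq phi (h i) | i <- enum 'I_n].
    by rewrite map_f // mem_enum.
  by exists d; rewrite mxpoly.conjVmx.
by exists P, D.
Qed.
End Coroots.

(** * The resolution product as an operation on polynomials *)

Lemma linprod_sumset_perm (C : closedFieldType) n (W1 W2 V1 V2 : seq 'rV[C]_n) :
  perm_eq W1 V1 -> perm_eq W2 V2 ->
  linprod (sumset W1 W2) = linprod (sumset V1 V2).
Proof.
move=> W1V W2V; rewrite !linprod_sumset (perm_big _ W1V).
by apply: eq_bigr => c _; rewrite (perm_big _ W2V).
Qed.

Theorem theorem4p3 (R : realType) (L : vectType R[i]) (br : L -> L -> L)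
    (H : {vspace L}) (n : nat) (al : 'I_n -> L -> R[i]) (h : 'I_n -> L) :
  lie_bracket br -> lie_simple br -> cartan br H ->
  simple_roots br H al -> (forall i, coroot br H (al i) (h i)) ->
  basis_of H [seq h i | i <- enum 'I_n] ->
  let CP := fun p : {mpoly R[i][n.+1]} =>
    exists (N : nat) (phi : L -> 'M[R[i]]_N), lie_rep br phi /\ p = ftilde h phi in
  exists op : {mpoly R[i][n.+1]} -> {mpoly R[i][n.+1]} -> {mpoly R[i][n.+1]},
    [/\ (forall (N M : nat) (phi : L -> 'M[R[i]]_N) (psi : L -> 'M[R[i]]_M),
           lie_rep br phi -> lie_rep br psi ->
           op (ftilde h phi) (ftilde h psi) = resprod h phi psi),
        (forall p q, CP p -> CP q -> CP (op p q)),
        (forall p q r, CP p -> CP q -> CP r -> op p (op q r) = op (op p q) r),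
        (forall p q, CP p -> CP q -> op p q = op q p) &
        CP 'X_0 /\ (forall p, CP p -> op 'X_0 p = p /\ op p 'X_0 = p)].
Proof.
move=> _ _ _ _ hP _ CP.
(* Unique factorization makes the multiset of forms a function of the polynomial. For a polynomial
   that is not such a product any list will do, here the empty one, so that [op] is total. *)
have /boolp.choice[wts wtsP] (p : {mpoly R[i][n.+1]}) :
    exists W, forall V, p = linprod V -> perm_eq W V.
  have [[W ->]|nW] := boolp.EM (exists W, p = linprod W).
    by exists W => V; exact: linprod_perm.
  by exists [::] => V pV; case: nW; exists V.
pose op p q := linprod (sumset (wts p) (wts q)).
(* [wts] recovers a list only up to order, which the product over a sumset does not see. *)
have opE V W : op (linprod V) (linprod W) = linprod (sumset V W).
  by apply: linprod_sumset_perm; exact: wtsP.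
have CPE p : CP p -> exists W, p = linprod W.
  case=> N [phi [phiR ->]].
  have [P [D PD]] := coroot_codiagonalizes hP phiR.
  by exists (diag_weights D); rewrite (ftilde_diag PD).
have X0E : 'X_0 = linprod [:: 0] :> {mpoly R[i][n.+1]}.
  rewrite /linprod big_seq1 /linform big1 ?addr0 // => i _.
  by rewrite mxE mpolyC0 mul0r.
exists op; split.
- move=> N M phi psi phiR psiR.
  have [P [D PD]] := coroot_codiagonalizes hP phiR.
  have [Q [E QE]] := coroot_codiagonalizes hP psiR.
  by rewrite (ftilde_diag PD) (ftilde_diag QE) opE (resprod_diag PD QE).
- move=> _ _ [N [phi [phiR ->]]] [M [psi [psiR ->]]].
  have [P [D PD]] := coroot_codiagonalizes hP phiR.
  have [Q [E QE]] := coroot_codiagonalizes hP psiR.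
  exists _, (tensor_rep phi psi); split; first exact: tensor_lie_rep.
  by rewrite (ftilde_diag PD) (ftilde_diag QE) opE (ftilde_tensor PD QE).
- move=> _ _ _ /CPE[U ->] /CPE[V ->] /CPE[W ->]; rewrite !opE !linprod_sumset.
  rewrite [RHS]big_allpairs_dep; apply: eq_bigr => u _.
  rewrite big_allpairs_dep; apply: eq_bigr => v _.
  by apply: eq_bigr => w _; rewrite addrA.
- move=> _ _ /CPE[U ->] /CPE[V ->]; rewrite !opE !linprod_sumset exchange_big.
  by apply: eq_bigr => v _; apply: eq_bigr => u _; rewrite addrC.
split.
  (* The trivial one-dimensional representation has [z_0] as its polynomial. *)
  exists 1%N, (fun=> 0); split.
    by split=> *; rewrite ?scaler0 ?addr0 ?mulmx0 ?subrr.
  rewrite /ftilde det_mx11 !mxE eqxx mul1r big1 ?addr0 // => i _.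
  by rewrite mpolyC0 mul0r.
move=> _ /CPE[U ->]; rewrite X0E !opE !linprod_sumset big_seq1.
split; first by apply: eq_bigr => u _; rewrite add0r.
by apply: eq_bigr => u _; rewrite big_seq1 addr0.
Qed.
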